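(* Let $I\subset\mathbb{K}[\mathbb{P}^n]$ be a radical homogeneous ideal with linearly bounded symbolic regularity. Then $\operatorname{aHP}_I$ exists (that is, the limit defining $\operatorname{aHP}_I(t)$ exists), and $\operatorname{aHP}_I(t)=\operatorname{aHF}_I(t)$ for all sufficiently large integers $t$.
   Context: $\mathbb{K}$ is an algebraically closed field of characteristic zero, $n$ is a positive integer, and $\mathbb{K}[\mathbb{P}^n]=\mathbb{K}[x_1,\dots,x_{n+1}]$ with the standard grading. The $m$-th symbolic power of a homogeneous radical ideal $I$ is $I^{(m)}=\mathbb{K}[\mathbb{P}^n]\cap\bigcap_{Q\in\operatorname{Ass}(I)}(I^m)_Q$, where the localizations are embedded in the field of fractions of $\mathbb{K}[\mathbb{P}^n]$. For a homogeneous ideal $J$, $\operatorname{HF}_J(t)=\dim_{\mathbb{K}}(\mathbb{K}[\mathbb{P}^n]_t/J_t)$ is the Hilbert function and $\operatorname{HP}_J$ is the Hilbert polynomial (the polynomial agreeing with $\operatorname{HF}_J(t)$ for $t\gg0$). For integers $t>0$ define $$\operatorname{aHF}_I(t)=\lim_{m\to\infty}\frac{\operatorname{HF}_{I^{(m)}}(mt)}{m^n},\qquad \operatorname{aHP}_I(t)=\lim_{m\to\infty}\frac{\operatorname{HP}_{I^{(m)}}(mt)}{m^n}$$ (the first limit exists for every homogeneous radical ideal). $I$ has linearly bounded symbolic regularity (is LBSR) if there exist constants $a,b>0$ such that $\operatorname{reg}(I^{(m)})\le am+b$ for all sufficiently large $m$, where $\operatorname{reg}$ is the Castelnuovo–Mumford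 regularity. *)

(* Defs.v *)
(* mpoly has to be imported before the analysis files: Rocq rejects the other
   order because of incompatible notation levels. *)
From HB Require Import structures.
From mathcomp Require Import all_boot all_order all_algebra.
From mathcomp Require Import mpoly.
From mathcomp Require Import all_classical all_reals.
From mathcomp Require Import ereal topology normedtype sequences.

Set Implicit Arguments.
Unset Strict Implicit.
Unset Printing Implicit Defensive.

Import Order.TTheory GRing.Theory Num.Theory.
Import numFieldNormedType.Exports.

Local Open Scope classical_set_scope.
Local Open Scope ring_scope.

(* K[P^n] = K[x_1, ..., x_(n+1)] *)
Notation homog_coord_ring K n := {mpoly K[n.+1]}.

Section Ideals.
Variable S : idomainType.
Implicit Types (I J Q : set S).

Definition is_ideal J : Prop :=
  [/\ J 0, forall p q, J p -> J q -> J (p + q) & forall a p, J p -> J (a * p)].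

Definition ideal_gen (A : set S) : set S := smallest is_ideal A.

Definition ideal_pow I (m : nat) : set S :=
  ideal_gen [set \prod_(i < m) f i | f in [set f : 'I_m -> S | forall i, I (f i)]].

Definition is_radical I : Prop := forall p (k : nat), I (p ^+ k) -> I p.

Definition is_prime Q : Prop :=
  [/\ is_ideal Q, ~ Q 1 & forall p q, Q (p * q) -> Q p \/ Q q].

(* Ass(I) is the set of associated primes of the S-module S / I:
   the primes that are annihilators (I : f) of the class of some f. *)
Definition Ass I : set (set S) :=
  [set Q | is_prime Q /\ exists f, Q = [set g | I (g * f)]].

(* J_Q, inside the field of fractions of S *)
Definition localization J Q : set {fraction S} :=
  [set FracField.tofrac p / FracField.tofrac s | p in J & s in ~` Q].

Definition symbolic_power I (m : nat) : set S :=
  [set p | forall Q, Ass I Q ->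
     localization (ideal_pow I m) Q (FracField.tofrac p)].

End Ideals.

Section GradedIdeals.
Variables (K : fieldType) (n : nat).
Local Notation S := (homog_coord_ring K n).
Implicit Types (I J : set S).

Definition is_homogeneous J : Prop :=
  forall p (d : nat), J p -> J (pihomog mdeg d p).

(* J_t. The space V in the comprehension exists and is unique when J is an
   ideal. *)
Definition graded_piece J (t : nat) : {vspace dhomog n.+1 K t} :=
  xget 0%VS [set V | forall v : dhomog n.+1 K t, v \in V <-> J (val v)].

(* V^C is a linear complement of V, hence isomorphic to the quotient by V. *)
Definition HF J (t : nat) : nat := \dim (graded_piece J t)^C%VS.

Definition HP J : {poly rat} :=
  xget 0 [set P | \forall t \near \oo, (HF J t)%:R = P.[t%:R]].

(* Graded complexes of finite free modules augmented to S
     ... -> F_2 -> F_1 -> F_0 -> S,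
   where F_i is the direct sum of the S(- gdeg i j), j < grank i.
   Elements of F_i are row vectors, on which matrices act on the right.
   Degrees in nat are enough: in a minimal resolution of an ideal of S no basis
   element has negative degree. *)
Record graded_free_data := GradedFreeData {
  grank : nat -> nat;
  gdeg : forall i, 'I_(grank i) -> nat;
  gaug : 'cV[S]_(grank 0);
  gdiff : forall i, 'M[S]_(grank i.+1, grank i)
}.

(* The maps preserve degrees. *)
Definition is_graded (F : graded_free_data) : Prop :=
  (forall j, gaug F j 0 \is (gdeg j).-homog) /\
  (forall i (j : 'I_(grank F i.+1)) (k : 'I_(grank F i)),
     if (gdeg k <= gdeg j)%N
     then gdiff F i j k \is (gdeg j - gdeg k)%N.-homog
     else gdiff F i j k == 0).

Definition is_resolution J (F : graded_free_data) : Prop :=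
  [/\ forall p, J p <-> exists v : 'rV[S]_(grank F 0), p = (v *m gaug F) 0 0,
      forall v : 'rV[S]_(grank F 0),
        v *m gaug F = 0 <-> exists w, v = w *m gdiff F 0
    & forall i (v : 'rV[S]_(grank F i.+1)),
        v *m gdiff F i = 0 <-> exists w, v = w *m gdiff F i.+1].

(* F_(i+1) is sent into (x_1, ..., x_(n+1)) F_i. *)
Definition is_minimal (F : graded_free_data) : Prop :=
  forall i j k, (gdiff F i j k)@_0%MM = 0.

Definition minimal_graded_free_resolution J (F : graded_free_data) : Prop :=
  [/\ is_graded F, is_resolution J F & is_minimal F].

End GradedIdeals.

Section Asymptotics.
Variables (R : realType) (K : fieldType) (n : nat).
Local Notation S := (homog_coord_ring K n).
Implicit Types (I J : set S).

(* -oo exactly when all the F_i are 0, i.e. for the zero ideal. *)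
Definition resolution_reg (F : graded_free_data K n) : \bar R :=
  ereal_sup [set x | exists i (j : 'I_(grank F i)),
    x = ((gdeg j)%:R - i%:R)%:E].

(* Castelnuovo-Mumford regularity of the graded module J (not of S / J). A minimal graded free
   resolution is unique up to isomorphism, so the infimum is taken over a
   singleton. *)
Definition CM_reg J : \bar R :=
  ereal_inf [set resolution_reg F | F in [set F |
    minimal_graded_free_resolution J F]].

Definition LBSR I : Prop :=
  exists a b : R, [/\ 0 < a, 0 < b &
    \forall m \near \oo,
      (CM_reg (symbolic_power I m) <= (a * m%:R + b)%:E)%E].

Definition aHF_seq I (t : nat) : R ^nat :=
  fun m => (HF (symbolic_power I m) (m * t))%:R / m%:R ^+ n.

Definition aHP_seq I (t : nat) : R ^nat :=
  fun m => ratr (HP (symbolic_power I m)).[(m * t)%:R] / m%:R ^+ n.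

Definition aHF I (t : nat) : R := limn (aHF_seq I t).

Definition aHP I (t : nat) : R := limn (aHP_seq I t).

End Asymptotics.

(* Main.v *)
(* Fix a monomial order and let U_m be the set of leading monomials of I^(m).
   It is closed under multiplication by monomials, and U_a U_b is contained in
   U_(a+b).  For M = k m + r, dividing exponents by k sends the monomials of
   degree at most M t outside U_M to monomials of degree at most m t outside
   U_m, with fibres of at most k^(n+1) elements, up to O(M^n) exceptions.  So if
   N_m(t) counts the monomials of degree at most m t outside U_m, then
   limsup_M N_M(t) / M^(n+1) <= N_m(t) / m^(n+1) for every m > 0, and
   N_m(t) / m^(n+1) converges as m grows.

   N_m(t) is also the sum of HF_(I^(m))(d) for d <= m t.  A minimal resolution
   has length at most n, so linearly bounded regularity makes this sum equal to
   Q_m(m t), with Q_m a polynomial of degree at most n + 1, as soon as t is at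
   least a constant A independent of m.  The polynomials
   q_m(x) = Q_m(m x) / m^(n+1) converge at the integers x >= A, hence
   coefficientwise.  Since HP_(I^(m))(d) = Q_m(d) - Q_m(d - 1),
     HP_(I^(m))(m t) / m^n = m (q_m(t) - q_m(t - 1/m))
   converges for every t, and for t > A it equals HF_(I^(m))(m t) / m^n. *)

Require Import Defs.
From HB Require Import structures.
From mathcomp Require Import all_boot all_order all_algebra.
From mathcomp Require Import mpoly.
From mathcomp Require Import all_classical all_reals.
From mathcomp Require Import ereal topology normedtype sequences.
From mathcomp Require Import zify lra.

Set Implicit Arguments.
Unset Strict Implicit.
Unset Printing Implicit Defensive.

Import Order.TTheory GRing.Theory Num.Theory.
Import numFieldNormedType.Exports.

Local Open Scope classical_set_scope.
Local Open Scope ring_scope.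

(** * Dimension of subspaces of arbitrary vector spaces *)

Section Dimension.
Variable K : fieldType.

(** Phrased through explicit bases, because ambient spaces such as polynomial rings are
    infinite-dimensional. *)
Definition has_dim (V : lmodType K) (A : set V) (d : nat) : Prop :=
  exists e : 'I_d -> V,
    (forall c : 'rV[K]_d, \sum_i c 0 i *: e i = 0 -> c = 0) /\
    (forall v, A v <-> exists c : 'rV[K]_d, v = \sum_i c 0 i *: e i).

Definition is_subspace (V : lmodType K) (A : set V) : Prop :=
  A 0 /\ forall a u v, A u -> A v -> A (a *: u + v).

Lemma subspace_sum (V : lmodType K) (A : set V) d (e : 'I_d -> V)
    (c : 'rV[K]_d) :
  is_subspace A -> (forall i, A (e i)) -> A (\sum_i c 0 i *: e i).
Proof.
move=> [A0 AP] eA; elim/big_rec: _ => // i x _ Ax.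
by rewrite -[_ *: _ + x]/(c 0 i *: e i + x); apply: AP.
Qed.

Lemma lincomb_linear (V : lmodType K) d (e : 'I_d -> V) a (b c : 'rV[K]_d) :
  \sum_i (a *: b + c) 0 i *: e i =
  a *: (\sum_i b 0 i *: e i) + \sum_i c 0 i *: e i.
Proof.
rewrite scaler_sumr -big_split; apply: eq_bigr => i _ /=.
by rewrite !mxE scalerDl scalerA.
Qed.

Lemma lincomb_mulmx (V : lmodType K) d d' (e : 'I_d -> V) (c : 'rV[K]_d')
    (M : 'M[K]_(d', d)) :
  \sum_i (c *m M) 0 i *: e i = \sum_j c 0 j *: (\sum_i M j i *: e i).
Proof.
under [RHS]eq_bigr do rewrite scaler_sumr.
rewrite exchange_big; apply: eq_bigr => i _ /=.
by rewrite mxE scaler_suml; apply: eq_bigr => j _; rewrite scalerA.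
Qed.

Lemma has_dim_leq (V : lmodType K) (A B : set V) d d' :
  A `<=` B -> has_dim A d -> has_dim B d' -> (d <= d')%N.
Proof.
move=> AB [e [e0 eA]] [f [_ fB]].
have fe i : exists c : 'rV[K]_d', e i = \sum_j c 0 j *: f j.
  apply/fB/AB/eA; exists (delta_mx 0 i).
  rewrite (bigD1 i) //= big1 ?addr0 ?mxE ?eqxx ?scale1r // => j ji.
  by rewrite mxE (negbTE ji) scale0r.
have [c cE] := choice fe.
pose M := \matrix_(i < d) c i.
suff: row_free M by move=> /eqP <-; exact: rank_leq_col.
apply/inj_row_free => v vM0; apply: e0.
transitivity (\sum_j (v *m M) 0 j *: f j); last first.
  by rewrite vM0 big1 // => j _; rewrite mxE scale0r.
rewrite lincomb_mulmx; apply: eq_bigr => i _; rewrite cE.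
by congr (_ *: _); apply: eq_bigr => j _; rewrite !mxE.
Qed.

Lemma has_dim_unique (V : lmodType K) (A : set V) d d' :
  has_dim A d -> has_dim A d' -> d = d'.
Proof.
by move=> Ad Ad'; apply/eqP; rewrite eqn_leq !(@has_dim_leq _ A A).
Qed.

(** A [U] of maximal dimension inside [A] is all of [A]: adding the line through a vector of [A]
    cannot enlarge it. *)
Lemma subspace_vspace (vT : vectType K) (A : set vT) :
  is_subspace A -> exists U : {vspace vT}, forall v, v \in U <-> A v.
Proof.
move=> [A0 AP].
pose P k := `[< exists2 U : {vspace vT}, \dim U = k & forall v, v \in U -> A v >].
have P0 : exists k, P k.
  exists 0%N; apply/asboolP; exists 0%VS; first exact: dimv0.
  by move=> v; rewrite memv0 => /eqP ->.
have Pmax k : P k -> (k <= \dim {:vT})%N.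
  by move=> /asboolP [U <- _]; apply/dimvS/subvf.
have [k /asboolP [U <- UA] kmax] := ex_maxnP P0 Pmax.
exists U => v; split=> [/UA //|Av].
have : P (\dim (<[v]> + U)%VS).
  apply/asboolP; exists (<[v]> + U)%VS => // w /memv_addP [x].
  by move=> /vlineP [a ->] [y /UA Ay ->]; apply: AP.
move=> /kmax; rewrite leqNgt => ltU.
have : (U == <[v]> + U)%VS by rewrite -(geq_leqif (dimv_leqif_eq (addvSr _ _))) leqNgt.
by move=> /eqP ->; rewrite -[v in v \in _]addr0 memv_add ?memv_line ?mem0v.
Qed.

Lemma has_dim_image (vT : vectType K) (V : lmodType K) (f : vT -> V)
    (U : {vspace vT}) (A : set V) :
  linear f -> (forall u, u \in U -> f u = 0 -> u = 0) ->
  (forall v, A v <-> exists2 u, u \in U & v = f u) ->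
  has_dim A (\dim U).
Proof.
move=> lf finj fA.
pose F := HB.pack_for {linear vT -> V} f
  (GRing.isLinear.Build K vT V *:%R f lf).
have fE : f =1 F by [].
have fsum (c : 'rV[K]_(\dim U)) :
    \sum_i c 0 i *: f (vbasis U)`_i = f (\sum_i c 0 i *: (vbasis U)`_i).
  by rewrite fE linear_sum; apply: eq_bigr => i _; rewrite linearZ.
exists (fun i => f (vbasis U)`_i); split=> [c|v].
  rewrite fsum => /finj c0.
  have /freeP := basis_free (vbasisP U) => /(_ (fun i => c 0 i)) ci.
  apply/rowP => i; rewrite mxE; apply: ci; apply: c0.
  by apply: rpred_sum => j _; apply: rpredZ; rewrite vbasis_mem ?mem_nth ?size_tuple.
rewrite fA; split=> [[u Uu ->]|[c ->]].
  exists (\row_i coord (vbasis U) i u); rewrite fsum; congr f.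
  by rewrite {1}(coord_vbasis Uu); apply: eq_bigr => i _; rewrite mxE.
exists (\sum_i c 0 i *: (vbasis U)`_i); last by rewrite fsum.
by apply: rpred_sum => j _; apply: rpredZ; rewrite vbasis_mem ?mem_nth ?size_tuple.
Qed.

(** A basis identifies [A] with K^d. There the kernel [U] of [g] has a complement, on which [g] is
    injective with the same image. *)
Lemma rank_nullity (V W : lmodType K) (g : {linear V -> W}) (A : set V) d :
  has_dim A d ->
  exists d1 d2, [/\ (d1 + d2)%N = d, has_dim (A `&` [set v | g v = 0]) d1
    & has_dim (g @` A) d2].
Proof.
move=> [e [e0 eA]].
pose f (c : 'rV[K]_d) := \sum_i c 0 i *: e i.
have lf : linear f by move=> a b c; exact: lincomb_linear.
have lgf : linear (g \o f) by move=> a b c /=; rewrite lf linearP.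
have f0 : f 0 = 0 by rewrite /f big1 // => i _; rewrite mxE scale0r.
have [|U UE] := @subspace_vspace 'rV[K]_d [set c | g (f c) = 0].
  split=> [/=|a u v /= u0 v0]; first by rewrite f0 linear0.
  by rewrite lf linearP u0 v0 scaler0 addr0.
exists (\dim U), (\dim U^C)%VS; split.
- rewrite dimv_compl dimvf /dim /= mul1n subnKC //.
  by rewrite (leq_trans (dimvS (subvf U))) // dimvf /dim /= mul1n.
- apply: (has_dim_image lf) => [u _ /e0 //|v]; split=> [[/eA [c ->] cg]|[u /UE /= u0 ->]].
    by exists c => //; apply/UE.
  by split=> //; apply/eA; exists u.
- apply: (has_dim_image lgf) => [u uC /= /UE uU|w].
    have : u \in (U :&: U^C)%VS by rewrite memv_cap uU.
    by rewrite capv_compl memv0 => /eqP.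
  split=> [[v /eA [c ->] <-]|[u _ ->]]; last by exists (f u) => //; apply/eA; exists u.
  have /memv_addP [u uU [u' uC cE]] : c \in (U + U^C)%VS by rewrite addv_complf memvf.
  exists u' => //=; rewrite -/(f c) cE -[u]scale1r lf linearP.
  by move/UE: uU => /= ->; rewrite scaler0 add0r.
Qed.

End Dimension.

(** * Leading monomials and the Hilbert function *)

Section LeadingMonomials.
Variable K : fieldType.

Definition lead_monomials n (A : set {mpoly K[n]}) : set 'X_{1..n} :=
  [set a | exists p, [/\ A p, p != 0 & mlead p = a]].

Definition homog_part n (A : set {mpoly K[n]}) d : set {mpoly K[n]} :=
  A `&` [set p | p \is d.-homog].

(** Pick one monic element of [A] per leading monomial. These are independent, since the largest
    leading monomial involved cannot cancel, and they span, since subtracting a multiple of one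
    lowers the leading monomial. *)
Lemma has_dim_lead_monomials n b (A : set {mpoly K[n]}) :
  is_subspace A -> (forall p, A p -> p != 0 -> (mdeg (mlead p) < b)%N) ->
  has_dim A #|[set a : 'X_{1..n < b} | `[< lead_monomials A a >]]%SET|.
Proof.
move=> sA Ab; have [A0 AP] := sA; set X := [set _ | _]%SET.
have lt_lead i : exists p, [/\ A p,
    mlead p = @enum_val _ (mem X) i :> 'X_{1..n} & mleadc p = 1].
  have := enum_valP i; rewrite inE => /asboolP [p [Ap p0 <-]].
  have c0 : (mleadc p)^-1 != 0 by rewrite invr_eq0 mleadc_eq0.
  exists ((mleadc p)^-1 *: p); split.
  - by rewrite -[_ *: p]addr0; apply: AP.
  - exact: mleadZ.
  - by rewrite mleadcZE mulVf // mleadc_eq0.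
have [p pP] := choice lt_lead.
pose a i : 'X_{1..n} := @enum_val _ (mem X) i.
have a_inj : injective a by move=> i j /val_inj /enum_val_inj.
have pa i : mlead (p i) = a i by have [] := pP i.
exists p; split=> [c c0|q].
  apply/eqP; apply: contraT => /rV0Pn [i0 ci0].
  have := @arg_maxP _ 'X_{1..n} _ i0 (fun i => c 0 i != 0) a ci0; case=> i ci imax.
  move/(congr1 (mcoeff (a i))): c0; rewrite mcoeff0 raddf_sum (bigD1 i) //=.
  rewrite big1 => [|j ji].
    rewrite addr0 mcoeffZ -pa; have [_ _ ->] := pP i.
    by rewrite mulr1 => /eqP; rewrite (negbTE ci).
  rewrite mcoeffZ; have [->|/imax aji] := eqVneq (c 0 j) 0; first by rewrite mul0r.
  rewrite mcoeff_gt_mlead ?mulr0 // pa lt_neqAle.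
  by rewrite (inj_eq a_inj) ji; exact: aji.
split=> [|[c ->]]; last first.
  by apply: subspace_sum => // i; case: (pP i).
elim/mleadrect: q => q IH Aq.
have [->|q0] := eqVneq q 0.
  by exists 0; rewrite big1 // => i _; rewrite mxE scale0r.
pose bq := BMultinom (Ab _ Aq q0).
have bqX : bq \in X by rewrite inE; apply/asboolP; exists q.
have ai : a (enum_rank_in bqX bq) = mlead q by rewrite /a enum_rankK_in.
move: (enum_rank_in bqX bq) ai => i ai.
pose r := q - mleadc q *: p i.
have Ar : A r.
  rewrite /r addrC -scaleNr; apply: AP => //.
  by case: (pP i).
have [c rE] : exists c : 'rV_#|X|, r = \sum_i c 0 i *: p i.
  have [->|r0] := eqVneq r 0.
    by exists 0; rewrite big1 // => j _; rewrite mxE scale0r.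
  apply: IH => //; rewrite lt_neqAle; apply/andP; split.
    apply/eqP => rq; move: r0; rewrite -mleadc_eq0 rq /r mcoeffB mcoeffZ.
    by have [_ _] := pP i; rewrite pa ai => ->; rewrite mulr1 subrr eqxx.
  apply: le_trans (mleadB_le _ _) _.
  by rewrite mleadZ ?mleadc_eq0 // pa ai joinxx.
exists (mleadc q *: delta_mx 0 i + c); rewrite lincomb_linear -rE.
rewrite (bigD1 i) //= big1 ?addr0 ?mxE ?eqxx ?scale1r /r => [|j ji].
  by rewrite addrC subrK.
by rewrite mxE (negbTE ji) scale0r.
Qed.

Lemma ideal_scale n (J : set {mpoly K[n]}) c p :
  is_ideal J -> J p -> J (c *: p).
Proof. by move=> [_ _ JM] Jp; rewrite -mul_mpolyC; apply: JM. Qed.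

Lemma ideal_subspace n (J : set {mpoly K[n]}) : is_ideal J -> is_subspace J.
Proof.
move=> iJ; have [J0 JD _] := iJ; split=> // a u v Ju Jv.
by apply: JD => //; apply: ideal_scale.
Qed.

Lemma homog_part_subspace n (J : set {mpoly K[n]}) d :
  is_subspace J -> is_subspace (homog_part J d).
Proof.
move=> [J0 JP]; split; first by split=> //=; apply: rpred0.
move=> a u v [Ju /= hu] [Jv /= hv]; split; first exact: JP.
by rewrite /= rpredD // rpredZ.
Qed.

Lemma mdeg_homog_lead n d (p : {mpoly K[n]}) :
  p \is d.-homog -> p != 0 -> mdeg (mlead p) = d.
Proof. by move=> /dhomogP hp p0; apply/hp/mlead_supp. Qed.

Lemma mcoeff_pihomog n d (p : {mpoly K[n]}) m :
  (pihomog mdeg d p)@_m = if mdeg m == d then p@_m else 0.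
Proof.
elim/mpolyind: p => [|c m' p _ _ IH].
  by rewrite linear0 mcoeff0 if_same.
rewrite linearP /= pihomogX !mcoeffD IH !mcoeffZ.
have [->|mm'] := eqVneq m m'.
  by case: eqP => // _; rewrite mcoeff0 mulr0 addr0.
by case: (mdeg m' == d); rewrite !mcoeffX ?mcoeff0 [m' == m]eq_sym (negbTE mm');
  case: ifP => _; rewrite ?mulr0 ?addr0.
Qed.

Lemma mlead_pihomog n (p : {mpoly K[n]}) : p != 0 ->
  pihomog mdeg (mdeg (mlead p)) p != 0 /\
  mlead (pihomog mdeg (mdeg (mlead p)) p) = mlead p.
Proof.
move=> p0; set q := pihomog _ _ _.
have q1 : q@_(mlead p) != 0 by rewrite mcoeff_pihomog eqxx mleadc_eq0.
have q0 : q != 0 by apply: contraNneq q1 => ->; rewrite mcoeff0.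
split=> //; apply/le_anti/andP; split; last first.
  by apply: msupp_le_mlead; rewrite mcoeff_msupp.
apply: msupp_le_mlead; move/mlead_supp: (q0); rewrite !mcoeff_msupp.
by rewrite {1}/q mcoeff_pihomog; case: ifP => //; rewrite eqxx.
Qed.

Lemma lead_monomials_homog_part n d (J : set {mpoly K[n]}) a :
  (forall p e, J p -> J (pihomog mdeg e p)) ->
  lead_monomials (homog_part J d) a <-> mdeg a = d /\ lead_monomials J a.
Proof.
move=> hJ; split=> [[p [[Jp /= hp] p0 <-]]|[<- [p [Jp p0 pa]]]].
  by split; [exact: mdeg_homog_lead | exists p].
have [q0 qp] := mlead_pihomog p0; rewrite -pa.
exists (pihomog mdeg (mdeg (mlead p)) p); split=> //; split; first exact: hJ.
exact: pihomogP.
Qed.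

Lemma has_dim_homog_part n d b (J : set {mpoly K[n]}) : (d < b)%N ->
  is_subspace J -> (forall p e, J p -> J (pihomog mdeg e p)) ->
  has_dim (homog_part J d)
    #|[set a : 'X_{1..n < b} | (mdeg a == d) && `[< lead_monomials J a >]]%SET|.
Proof.
move=> db sJ hJ.
have := @has_dim_lead_monomials n b _ (@homog_part_subspace _ _ d sJ).
set X := finset _; set Y := finset _; suff -> : X = Y.
  by apply=> p [_ /= hp] p0; rewrite (mdeg_homog_lead hp).
apply/setP => a; rewrite !inE; apply/asboolP/andP.
  by move/(lead_monomials_homog_part _ _ hJ) => [-> ?]; split=> //; apply/asboolP.
by move=> [/eqP ad /asboolP Ja]; apply/(lead_monomials_homog_part _ _ hJ).
Qed.

Lemma has_dim_homog n d :
  has_dim (homog_part setT d : set {mpoly K[n.+1]}) 'C(d + n, d).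
Proof.
have := @has_dim_image _ (dhomog n.+1 K d) {mpoly K[n.+1]} val fullv
  (homog_part setT d).
rewrite dimvf; apply=> // [u _ u0|p]; first exact/val_inj.
split=> [[_ /= hp]|[u _ ->]]; first by exists (DHomog hp); rewrite ?memvf.
by split=> //=; apply: dhomog_is_dhomog.
Qed.

Lemma HF_has_dim n (J : set {mpoly K[n.+1]}) d j :
  is_subspace J -> has_dim (homog_part J d) j -> (HF J d + j)%N = 'C(d + n, d).
Proof.
move=> sJ dJ; have [J0 JP] := sJ.
have [|U UJ] := @subspace_vspace K (dhomog n.+1 K d) [set v | J (val v)].
  by split=> // a u v /= Ju Jv; apply: JP.
have gE : forall v, v \in graded_piece J d <-> J (val v).
  by rewrite /graded_piece; case: xgetP => [V _ //|/(_ U)].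
have dV : has_dim (homog_part J d) (\dim (graded_piece J d)).
  apply: (@has_dim_image _ (dhomog n.+1 K d) _ val) => // [u _ u0|p].
    exact/val_inj.
  split=> [[Jp /= hp]|[u /gE Ju ->]]; first by exists (DHomog hp) => //; apply/gE.
  by split=> //=; apply: dhomog_is_dhomog.
rewrite (has_dim_unique dJ dV) /HF dimv_compl subnK ?dimvS ?subvf //.
by rewrite dimvf.
Qed.

(** Leading monomials count the dimension of J_d and, taken for the whole ring, that of S_d, where
    every monomial is one. Subtracting leaves the standard monomials. *)
Lemma HF_card n (J : set {mpoly K[n.+1]}) d b : (d < b)%N ->
  is_ideal J -> is_homogeneous J ->
  HF J d = #|[set a : 'X_{1..n.+1 < b} |
    (mdeg a == d) && `[< ~ lead_monomials J a >]]%SET|.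
Proof.
move=> db iJ hJ; have sJ := ideal_subspace iJ.
have cJ := has_dim_homog_part db sJ hJ.
have sT : is_subspace (setT : set {mpoly K[n.+1]}) by [].
have := has_dim_homog_part db sT (fun _ _ _ => Logic.I).
move/has_dim_unique => /(_ _ (has_dim_homog n d)) cT.
apply/eqP; rewrite -(eqn_add2r #|[set a : 'X_{1..n.+1 < b} |
  (mdeg a == d) && `[< lead_monomials J a >]]%SET|); apply/eqP.
rewrite (HF_has_dim sJ cJ) -cT.
set X := finset _; set Y := finset _; set Z := finset _.
rewrite -cardsUI (_ : Y :&: Z = finset.set0)%SET ?cards0 ?addn0; last first.
  apply/setP => a; rewrite !inE; apply/negP.
  by move=> /andP [/andP [_ /asboolP Ya] /andP [_ /asboolP]].
congr #|pred_of_set _|; apply/setP => a; rewrite !inE -andb_orr.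
case: eqP => //= ad; rewrite -asbool_or (_ : `[< _ \/ _ >] = true).
  apply/asboolP; exists 'X_[a]; split=> //; last exact: mleadXm.
  by apply/eqP => /(congr1 (mcoeff a))/eqP; rewrite mcoeffX eqxx mcoeff0 oner_eq0.
by apply/asboolP; have [] := EM (lead_monomials J a); [right|left].
Qed.

End LeadingMonomials.

(** * Length of minimal resolutions *)

Section Kill.
Variables (K : fieldType) (n : nat).
Local Notation S := {mpoly K[n]}.

(* [kill k] sets x_1, ..., x_k to 0, so [kill k p = kill k q] says that p and q
   are congruent modulo (x_1, ..., x_k). *)
Definition kill_tuple k : n.-tuple S :=
  [tuple if (i < k)%N then 0 else 'X_i | i < n].

Definition kill k (p : S) : S := p \mPo kill_tuple k.

HB.instance Definition _ k := GRing.RMorphism.copy (kill k)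
  (comp_mpoly (kill_tuple k)).

Lemma killC k c : kill k c%:MP = c%:MP.
Proof. exact: comp_mpolyC. Qed.

Lemma killXi k (i : 'I_n) : kill k 'X_i = if (i < k)%N then 0 else 'X_i.
Proof. by rewrite /kill comp_mpolyXU -tnth_nth tnth_mktuple. Qed.

(** Lets facts about ring morphisms be checked on constants and variables, which generate the
    ring. *)
Lemma mpoly_mul_ind (P : S -> Prop) :
  (forall c, P c%:MP) -> (forall i, P 'X_i) ->
  (forall p q, P p -> P q -> P (p + q)) ->
  (forall p q, P p -> P q -> P (p * q)) -> forall p, P p.
Proof.
move=> PC PX PD PM; elim/mpolyind => [|c m p _ _ Pp]; first by rewrite -[0]/(0%:MP).
apply: PD => //; rewrite -mul_mpolyC; apply: (PM) => //.
rewrite mpolyXE_id; apply: big_ind => [|p' q|i _].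
- by rewrite -[1]/(1%:MP).
- exact: PM.
by elim: (m i) => [|e IH]; [rewrite expr0 -[1]/(1%:MP) | rewrite exprS; apply: PM].
Qed.

Lemma kill_kill j k p : kill j (kill k p) = kill (maxn j k) p.
Proof.
elim/mpoly_mul_ind: p => [c|i|p q|p q]; first by rewrite !killC.
- rewrite !killXi leq_max; case: ifP => ik; last by rewrite killXi orbF.
  by rewrite rmorph0 orbT.
- by rewrite !rmorphD /= => -> ->.
- by rewrite !rmorphM /= => -> ->.
Qed.

Lemma kill0 p : kill 0 p = p.
Proof.
elim/mpoly_mul_ind: p => [c|i|p q|p q]; rewrite ?killC ?killXi //.
- by rewrite rmorphD /= => -> ->.
- by rewrite rmorphM /= => -> ->.
Qed.

Lemma kill_all p : kill n p = (p@_0%MM)%:MP.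
Proof.
elim/mpoly_mul_ind: p => [c|i|p q|p q]; rewrite ?killC ?killXi ?ltn_ord.
- by rewrite mcoeffC eqxx mulr1.
- rewrite mcoeffX; case: eqP => //= /(congr1 (fun m : 'X_{1..n} => m i)).
  by rewrite mnm1E eqxx mnm0E.
- by rewrite rmorphD /= => -> ->; rewrite mcoeffD mpolyCD.
- rewrite rmorphM /= => -> ->; rewrite -mpolyCM; congr _%:MP.
  by rewrite [RHS](rmorphM (mcoeff 0%MM)).
Qed.

Lemma kill_step (i : 'I_n) p :
  exists w, kill i p = kill i.+1 p + 'X_i * w.
Proof.
elim/mpoly_mul_ind: p => [c|j|p q [u pu] [v qv]|p q [u pu] [v qv]].
- by exists 0; rewrite !killC mulr0 addr0.
- rewrite !killXi ltnS (leq_eqVlt j); have [ji|_] /= := eqVneq (j : nat) i.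
    by exists 1; rewrite ji ltnn mulr1 add0r (val_inj ji).
  by exists 0; rewrite mulr0 addr0.
- by exists (u + v); rewrite !rmorphD /= pu qv mulrDr addrACA.
- exists (kill i.+1 p * v + u * kill i q); rewrite !rmorphM /= {1}pu mulrDl.
  by rewrite {1}qv !mulrDr mulrA -!addrA !mulrA [_ * 'X_i]mulrC.
Qed.

End Kill.

Section Syzygies.
Variables (K : fieldType) (n : nat).
Local Notation S := (homog_coord_ring K n).
Variables (J : set S) (F : graded_free_data K n).

(* The augmentation is treated as one more differential: [S] is the zeroth
   module, and F_i is the module of index i + 1. *)
Definition res_rank i : nat := if i is i'.+1 then grank F i' else 1.

Definition res_mx i : 'M[S]_(res_rank i.+1, res_rank i) :=
  match i with 0 => gaug F | i'.+1 => gdiff F i' end.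

Definition res_deg i : 'I_(res_rank i) -> nat :=
  match i with 0 => fun=> 0%N | i'.+1 => @gdeg _ _ F i' end.

Hypothesis Fres : is_resolution J F.

Lemma res_exact i (v : 'rV[S]_(res_rank i.+1)) :
  v *m res_mx i = 0 <-> exists w, v = w *m res_mx i.+1.
Proof. by case: Fres => _ F0 FS; case: i v. Qed.

Lemma res_complex i (w : 'rV[S]_(res_rank i.+2)) :
  w *m res_mx i.+1 *m res_mx i = 0.
Proof. by apply/res_exact; exists w. Qed.

Local Notation killm k := (map_mx (@kill K n.+1 k)).

(* Exactness at index i + 1 after reduction modulo (x_1, ..., x_k).  Passing from
   k to k + 1 costs one index, because x_(k+1) is regular on the modules reduced
   modulo (x_1, ..., x_k).  For k = n + 1 all differentials vanish by minimality,
   so exactness leaves only zero modules. *)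
Definition exact_mod k i := forall v : 'rV[S]_(res_rank i.+1),
  killm k (v *m res_mx i) = 0 ->
  exists y, killm k v = killm k (y *m res_mx i.+1).

(** A diagram chase, with x = x_(k+1). If [v] is a cycle modulo k+1 variables, then v d = x w modulo
    k variables. As d d = 0 and x is a nonzerodivisor, [w] is a cycle, hence the boundary of some
    [u]. Then v - x u is a cycle modulo k variables, hence a boundary, and it agrees with [v] once x
    is killed. *)
Lemma exact_modS k i : (k < n.+1)%N ->
  exact_mod k i -> exact_mod k i.+1 -> exact_mod k.+1 i.+1.
Proof.
move=> kn E1 E2 v v0; pose x : 'I_n.+1 := Ordinal kn.
have killx : kill k 'X_x = 'X_x :> S by rewrite killXi ltnn.
have wP j : exists w, kill k ((v *m res_mx i.+1) 0 j) = 'X_x * w.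
  have [w wE] := kill_step x ((v *m res_mx i.+1) 0 j); exists w.
  rewrite wE; move/matrixP/(_ 0 j): v0; rewrite !mxE /= => ->.
  by rewrite add0r.
have [w' w'P] := choice wP; pose w := \row_j w' j.
have vw : killm k (v *m res_mx i.+1) = 'X_x *: killm k w.
  apply/rowP => j; rewrite mxE [RHS]mxE [X in _ = _ * X]mxE.
  by rewrite -[in RHS]killx -rmorphM [w _ _]mxE -w'P /= kill_kill maxnn.
have [|u wu] := E1 w.
  have: killm k (v *m res_mx i.+1 *m res_mx i) = 0 by rewrite res_complex map_mx0.
  rewrite map_mxM vw -scalemxAl -map_mxM => /rowP xw0.
  apply/rowP => j; have /eqP := xw0 j; rewrite mxE [X in _ == X]mxE [X in _ -> _ = X]mxE.
  rewrite mulf_eq0 => /orP [/eqP /(congr1 (mcoeff U_(x)%MM)) /eqP|/eqP //].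
  by rewrite mcoeffX eqxx mcoeff0 oner_eq0.
have killZm k' (p : S) a (A : 'rV[S]_a) : killm k' (p *: A) = kill k' p *: killm k' A.
  by apply/rowP => j; rewrite !mxE rmorphM.
have [|y yE] := E2 (v - 'X_x *: u).
  rewrite mulmxBl map_mxB -scalemxAl killZm killx -wu vw subrr //.
exists y; have := congr1 (killm k.+1) yE.
have kk a (A : 'rV[S]_a) : killm k.+1 (killm k A) = killm k.+1 A.
  by apply/rowP => j; rewrite !mxE kill_kill (maxn_idPl (leqnSn k)).
by rewrite !kk map_mxB killZm killXi ltnS leqnn scale0r subr0.
Qed.

Lemma exact_modP k i : (k <= n.+1)%N -> (k <= i)%N -> exact_mod k i.
Proof.
elim: k i => [|k IH] i kn ki.
  have k0 a (A : 'rV[S]_a) : killm 0 A = A by apply/rowP => j; rewrite mxE kill0.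
  by move=> v; rewrite k0 => /res_exact [y yE]; exists y; rewrite !k0.
case: i ki => // i ki; apply: exact_modS => //; apply: IH => //.
- exact: ltnW.
- exact: ltnW.
- exact: leqW.
Qed.

Lemma syzygy_theorem i : is_minimal F -> (n < i)%N -> grank F i = 0%N.
Proof.
move=> Fmin ni; case r0: (grank F i) => [//|r].
have dk0 i' (y : 'rV[S]_(res_rank i'.+2)) : killm n.+1 (y *m res_mx i'.+1) = 0.
  rewrite map_mxM; suff -> : killm n.+1 (res_mx i'.+1) = 0 by rewrite mulmx0.
  by apply/matrixP => a b; rewrite !mxE kill_all Fmin mpolyC0.
(* Since [n < i] excludes i = 0, the map out of F_i is a differential and not the augmentation, so
   minimality applies to it. A basis vector [v] is then a cycle modulo all variables, hence a
   boundary, although boundaries vanish there. *)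
case: i ni r0 => // i ni r0.
pose j0 : 'I_(res_rank i.+2) := cast_ord (esym r0) ord0.
pose v : 'rV[S]_(res_rank i.+2) := delta_mx 0 j0.
have [y] := @exact_modP n.+1 i.+1 (leqnn _) ni v (dk0 _ v).
rewrite dk0 => /rowP /(_ j0); rewrite !mxE !eqxx rmorph1 => /eqP.
by rewrite oner_eq0.
Qed.

End Syzygies.

(** * Graded free modules *)

Section GradedDimension.
Variables (K : fieldType).

Lemma has_dim_finType (V : lmodType K) (T : finType) (e : T -> V) (A : set V) :
  (forall c : T -> K, \sum_x c x *: e x = 0 -> c =1 fun=> 0) ->
  (forall v, A v <-> exists c : T -> K, v = \sum_x c x *: e x) ->
  has_dim A #|T|.
Proof.
move=> e0 eA; exists (fun i => e (enum_val i)).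
have sumE (c : T -> K) : \sum_x c x *: e x =
    \sum_(i < #|T|) c (enum_val i) *: e (enum_val i).
  by rewrite (reindex _ (onW_bij _ (@enum_val_bij T))).
have sumE' (c : 'rV[K]_#|T|) : \sum_i c 0 i *: e (enum_val i) =
    \sum_x c 0 (enum_rank x) *: e x.
  by rewrite sumE; apply: eq_bigr => i _; rewrite enum_valK.
split=> [c|v].
  rewrite sumE' => /e0 c0; apply/rowP => i; rewrite mxE.
  by have := c0 (enum_val i); rewrite enum_valK.
rewrite eA; split=> [[c ->]|[c ->]].
  exists (\row_i c (enum_val i)); rewrite sumE.
  by apply: eq_bigr => i _; rewrite mxE.
by rewrite sumE'; eexists.
Qed.

Lemma has_dim_ffun (V : lmodType K) (I : finType) (A : I -> set V)
    (d : I -> nat) : (forall i, has_dim (A i) (d i)) ->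
  has_dim [set v : {ffun I -> V} | forall i, A i (v i)] (\sum_i d i).
Proof.
move=> Ad; pose e i := proj1_sig (cid (Ad i)).
have eP i : (forall c : 'rV[K]_(d i), \sum_k c 0 k *: e i k = 0 -> c = 0) /\
    (forall v, A i v <-> exists c : 'rV[K]_(d i), v = \sum_k c 0 k *: e i k).
  exact: proj2_sig (cid (Ad i)).
rewrite -(_ : #|{: {i : I & 'I_(d i)}}| = \sum_i d i)%N; last first.
  rewrite card_tagged sumnE big_map big_enum /=.
  by apply: eq_bigr => i _; rewrite card_ord.
pose E (x : {i : I & 'I_(d i)}) : {ffun I -> V} :=
  [ffun i => if tag x == i then e (tag x) (tagged x) else 0].
have sumE (c : {i : I & 'I_(d i)} -> K) i :
    (\sum_x c x *: E x) i = \sum_(k < d i) c (Tagged _ k) *: e i k.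
  transitivity (\sum_j \sum_(k < d j) (c (Tagged _ k) *: E (Tagged _ k)) i).
    rewrite sig_big_dep /= sum_ffunE; apply: eq_bigr => x _.
    by case: x.
  rewrite (bigD1 i) //= [X in _ + X]big1 ?addr0 => [|j ji].
    by apply: eq_bigr => k _; rewrite !ffunE /= eqxx.
  by apply: big1 => k _; rewrite !ffunE /= (negbTE ji) scaler0.
apply: (@has_dim_finType _ _ E) => [c c0 [i k]|v].
  have [e0 _] := eP i.
  suff /rowP/(_ k) : \row_k c (Tagged _ k) = 0 :> 'rV_(d i) by rewrite !mxE.
  apply: e0; transitivity ((\sum_x c x *: E x) i); last by rewrite c0 ffunE.
  by rewrite sumE; apply: eq_bigr => j _; rewrite mxE.
split=> [Av|[c ->] i]; last first.
  rewrite sumE; apply/(eP i).2; exists (\row_k c (Tagged _ k)).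
  by apply: eq_bigr => k _; rewrite mxE.
have vc i : exists c : 'rV[K]_(d i), v i = \sum_k c 0 k *: e i k.
  by apply/(eP i).2.
exists (fun x => proj1_sig (cid (vc (tag x))) 0 (tagged x)).
apply/ffunP => i; rewrite sumE /=.
by case: cid.
Qed.

Variable n : nat.
Local Notation S := {mpoly K[n]}.

Lemma pihomog_mulr (p q : S) d e : q \is e.-homog ->
  pihomog mdeg d (p * q) =
  if (e <= d)%N then pihomog mdeg (d - e)%N p * q else 0.
Proof.
move=> hq; elim/mpolyind: p => [|c m p _ _ IH].
  by rewrite mul0r !linear0 mul0r if_same.
have hm : 'X_[m] * q \is (mdeg m + e)%N.-homog.
  by apply: dhomogM => //; rewrite dhomogX.
rewrite mulrDl -scalerAl linearP /= IH linearP /= pihomogX.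
have [ed|ed] := leqP e d; last first.
  rewrite addr0 (@pihomog_ne0 _ _ _ _ _ _ _ hm) ?scaler0 //.
  by rewrite gtn_eqF // (leq_trans ed) // leq_addl.
rewrite mulrDl -scalerAl; congr (_ *: _ + _).
case: eqP => mde; first by rewrite pihomog_dE // -[d](subnK ed) -mde.
rewrite mul0r (@pihomog_ne0 _ _ _ _ _ _ _ hm) //.
by apply/eqP => dE; case: mde; rewrite -dE addnK.
Qed.

(** The degree [t] part of the direct sum of the S(- a j); the test guards against truncated
    subtraction. Finite functions form a vector space over [K], whereas row vectors would be a
    module over [S]. *)
Definition homog_row r (a : 'I_r -> nat) t : set {ffun 'I_r -> S} :=
  [set v | forall j, if (a j <= t)%N then v j \is (t - a j)%N.-homog else v j == 0].

Definition homog_mx r s (a : 'I_r -> nat) (b : 'I_s -> nat) (M : 'M[S]_(r, s)) :=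
  forall j k, if (b k <= a j)%N then M j k \is (a j - b k)%N.-homog
              else M j k == 0.

Definition ffun_mulmx r s (M : 'M[S]_(r, s)) (v : {ffun 'I_r -> S}) :
  {ffun 'I_s -> S} := [ffun k => ((\row_j v j) *m M) 0 k].

Lemma ffun_mulmx_linear r s (M : 'M[S]_(r, s)) : linear (ffun_mulmx M).
Proof.
move=> c u v; apply/ffunP => k; rewrite !ffunE !mxE scaler_sumr -big_split.
by apply: eq_bigr => j _; rewrite !mxE !ffunE mulrDl scalerAl.
Qed.

HB.instance Definition _ r s (M : 'M[S]_(r, s)) :=
  GRing.isLinear.Build K {ffun 'I_r -> S} {ffun 'I_s -> S} *:%R (ffun_mulmx M)
    (@ffun_mulmx_linear r s M).

Definition homog_proj r (a : 'I_r -> nat) t (v : {ffun 'I_r -> S}) :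
  {ffun 'I_r -> S} :=
  [ffun j => if (a j <= t)%N then pihomog mdeg (t - a j)%N (v j) else 0].

Lemma homog_projP r (a : 'I_r -> nat) t v : homog_row a t (homog_proj a t v).
Proof. by move=> j; rewrite ffunE; case: (_ <= _)%N; [exact: pihomogP | exact: eqxx]. Qed.

Lemma homog_proj_id r (a : 'I_r -> nat) t v :
  homog_row a t v -> homog_proj a t v = v.
Proof.
move=> hv; apply/ffunP => j; rewrite ffunE; have := hv j.
by case: (_ <= _)%N; [exact: pihomog_dE | move/eqP].
Qed.

(** This turns any preimage of a homogeneous element under a graded map into a homogeneous
    preimage. *)
Lemma homog_proj_mulmx r s (a : 'I_r -> nat) (b : 'I_s -> nat) M t v :
  homog_mx a b M ->
  homog_proj b t (ffun_mulmx M v) = ffun_mulmx M (homog_proj a t v).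
Proof.
move=> hM; apply/ffunP => k; rewrite !ffunE !mxE.
transitivity (\sum_j if (b k <= t)%N then pihomog mdeg (t - b k)%N (v j * M j k) else 0).
  case: ifP => _; last by rewrite big1.
  by rewrite linear_sum; apply: eq_bigr => j _; rewrite !mxE.
apply: eq_bigr => j _; rewrite !mxE ffunE; have := hM j k.
have [ba|ab] := leqP (b k) (a j); last first.
  by move=> /eqP ->; rewrite !mulr0 linear0 if_same.
move=> hjk; rewrite (pihomog_mulr _ _ hjk).
have [bt|tb] := leqP (b k) t; last first.
  by rewrite leqNgt (leq_trans tb ba) /= mul0r.
rewrite leq_sub2rE //; case: ifP => [jt|]; last by rewrite mul0r.
by congr (pihomog _ _ _ * _); lia.
Qed.

Lemma homog_row_mulmx r s (a : 'I_r -> nat) (b : 'I_s -> nat) M t v :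
  homog_mx a b M -> homog_row a t v -> homog_row b t (ffun_mulmx M v).
Proof.
move=> hM hv; rewrite -(homog_proj_id hv) -(homog_proj_mulmx _ _ hM).
exact: homog_projP.
Qed.

End GradedDimension.

Lemma has_dim_homog_row (K : fieldType) n r (a : 'I_r -> nat) t :
  has_dim (homog_row a t : set {ffun 'I_r -> {mpoly K[n.+1]}})
    (\sum_j if (a j <= t)%N then 'C(t - a j + n, t - a j) else 0).
Proof.
apply: (@has_dim_ffun K {mpoly K[n.+1]} _ (fun j => [set p | if (a j <= t)%N then
  p \is (t - a j)%N.-homog else p == 0])) => j /=.
case: ifP => _.
  have -> : [set p | p \is (t - a j)%N.-homog] =
      homog_part setT (t - a j) :> set {mpoly K[n.+1]}.
    by apply/seteqP; split=> p //= [].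
  exact: has_dim_homog.
exists (fun=> 0); split=> [c _|v]; first by apply/rowP => -[].
split=> [/= /eqP ->|[c ->] /=].
  by exists 0; rewrite big_ord0.
by rewrite big_ord0 eqxx.
Qed.

(** * Hilbert function of a resolved ideal *)

Lemma size_sum_leq (R : nzRingType) (I : finType) (f : I -> {poly R}) (N : nat) :
  (forall i, (size (f i) <= N)%N) -> (size (\sum_i f i)%R <= N)%N.
Proof.
move=> fN; apply: leq_trans (size_sum _ _ _) _.
by apply/bigmax_leqP => i _; apply: fN.
Qed.

Section HilbertFunction.
Variables (K : fieldType) (n : nat).
Local Notation S := (homog_coord_ring K n).
Variables (J : set S) (F : graded_free_data K n).
Hypotheses (idealJ : is_ideal J) (Fmin : minimal_graded_free_resolution J F).

Let Fres : is_resolution J F. Proof. by case: Fmin. Qed.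

Local Notation deg i := (@res_deg K n F i).
Local Notation d_ i := (res_mx F i).

Lemma res_homog_mx i : homog_mx (deg i.+1) (deg i) (d_ i).
Proof.
have [[Faug Fdiff] _ _] := Fmin.
case: i => [|i] j k /=; last exact: Fdiff.
by rewrite subn0 (ord1 k); apply: Faug.
Qed.

Lemma ffun_mulmx_eq0 i v :
  ffun_mulmx (d_ i) v = 0 <-> (\row_j v j) *m d_ i = 0.
Proof.
split=> [/ffunP v0|v0]; [apply/rowP|apply/ffunP] => k.
  by have := v0 k; rewrite !ffunE => ->; rewrite mxE.
by rewrite !ffunE v0 mxE.
Qed.

Lemma homog_row_exact i t :
  ffun_mulmx (d_ i.+1) @` homog_row (deg i.+2) t =
  homog_row (deg i.+1) t `&` [set v | ffun_mulmx (d_ i) v = 0].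
Proof.
apply/seteqP; split=> [_ [y hy <-]|v [hv /ffun_mulmx_eq0]].
  split; first exact: (homog_row_mulmx (@res_homog_mx i.+1) hy).
  apply/ffun_mulmx_eq0; rewrite -(@res_complex _ _ _ _ Fres _ (\row_j y j)).
  by congr (_ *m _); apply/rowP => j; rewrite mxE ffunE.
move/(res_exact Fres) => [w vw].
(* The preimage [w] given by exactness need not be homogeneous, but its degree [t] component still
   maps to [v]. *)
exists (homog_proj (deg i.+2) t [ffun j => w 0 j]); first exact: homog_projP.
rewrite -(homog_proj_mulmx _ _ (@res_homog_mx _)).
rewrite -[RHS](homog_proj_id hv); congr homog_proj.
apply/ffunP => k; rewrite ffunE.
have -> : \row_j [ffun j0 => w 0 j0] j = w.
  by apply/rowP => j; rewrite mxE ffunE.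
by rewrite -vw mxE.
Qed.

Definition aug_fun (v : {ffun 'I_(res_rank F 1) -> S}) : S :=
  ffun_mulmx (d_ 0) v ord0.

Lemma aug_fun_linear : linear aug_fun.
Proof. by move=> a u v; rewrite /aug_fun linearP !ffunE. Qed.

HB.instance Definition _ :=
  GRing.isLinear.Build K {ffun 'I_(res_rank F 1) -> S} S *:%R aug_fun
    aug_fun_linear.

Lemma aug_fun_eq0 v : aug_fun v = 0 <-> ffun_mulmx (d_ 0) v = 0.
Proof.
split=> [v0|v0]; last by rewrite /aug_fun v0 ffunE.
by apply/ffunP => k; rewrite [RHS]ffunE -v0 /aug_fun (ord1 k).
Qed.

Lemma aug_fun_image t : aug_fun @` homog_row (deg 1) t = homog_part J t.
Proof.
have [FJ _ _] := Fres.
apply/seteqP; split=> [_ [y hy <-]|p [/FJ [w pw] /= hp]].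
  split; first by apply/FJ; exists (\row_j y j); rewrite /aug_fun ffunE.
  have /(_ ord0) := homog_row_mulmx (@res_homog_mx 0) hy.
  by rewrite /= subn0.
exists (homog_proj (deg 1) t [ffun j => w 0 j]); first exact: homog_projP.
rewrite /aug_fun -(homog_proj_mulmx _ _ (@res_homog_mx _)) ffunE /= subn0 ffunE.
have -> : \row_j [ffun j0 => w 0 j0] j = w.
  by apply/rowP => j; rewrite mxE ffunE.
by rewrite -pw pihomog_dE.
Qed.

Lemma resolution_homogeneous : is_homogeneous J.
Proof.
have [FJ _ _] := Fres; move=> p t /FJ [w pw].
suff [] : homog_part J t (pihomog mdeg t p) by [].
rewrite -aug_fun_image.
exists (homog_proj (deg 1) t [ffun j => w 0 j]); first exact: homog_projP.
rewrite /aug_fun -(homog_proj_mulmx _ _ (@res_homog_mx _)) ffunE /= subn0 ffunE.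
have -> : \row_j [ffun j0 => w 0 j0] j = w.
  by apply/rowP => j; rewrite mxE ffunE.
by rewrite -pw.
Qed.

(** The dimension of the degree [t] part of the module of index [i], which is F_(i-1) when [i] is
    positive. *)
Definition free_dim i t : nat :=
  \sum_j (if (deg i j <= t)%N then 'C(t - deg i j + n, t - deg i j) else 0).

(** Here [z i.+1] is the dimension in degree [t] of the kernel inside F_i. Rank-nullity splits F_i
    into kernel and image; by exactness the image is the preceding kernel, or J_t for F_0. *)
Lemma resolution_dims t : exists z : nat -> nat,
  has_dim (homog_part J t) (z 0) /\
  forall i, free_dim i.+1 t = (z i.+1 + z i)%N.
Proof.
have rn i := rank_nullity (ffun_mulmx (d_ i)) (has_dim_homog_row K n (deg i.+1) t).
have ker_dim i : exists z, has_dim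
    (homog_row (deg i.+1) t `&` [set v | ffun_mulmx (d_ i) v = 0]) z.
  by have [d1 [d2 []]] := rn i; exists d1.
have [z zP] := choice ker_dim.
have [j0 [j [jE j0P jP]]] := rank_nullity aug_fun (has_dim_homog_row K n (deg 1) t).
rewrite aug_fun_image in jP.
exists (fun i => if i is i'.+1 then z i' else j); split=> //.
case=> [|i]; rewrite /free_dim.
  rewrite -jE; congr addn; apply: has_dim_unique (zP 0%N).
  rewrite (_ : [set v | ffun_mulmx (d_ 0) v = 0] = [set v | aug_fun v = 0]) //.
  by apply/seteqP; split=> v /= /aug_fun_eq0.
have [d1 [d2 [<- d1P]]] := rn i.+1; rewrite homog_row_exact => d2P.
by rewrite (has_dim_unique (zP _) d1P) (has_dim_unique (zP _) d2P).
Qed.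

Lemma HF_free_dim t :
  (HF J t)%:R = 'C(t + n, t)%:R -
    \sum_(i < n.+1) (-1) ^+ i * (free_dim i.+1 t)%:R :> rat.
Proof.
have [z [z0P zE]] := resolution_dims t.
have alt L : (z 0%N)%:R = \sum_(i < L) (-1) ^+ i * (free_dim i.+1 t)%:R
    + (-1) ^+ L * (z L)%:R :> rat.
  elim: L => [|L IH]; first by rewrite big_ord0 add0r mul1r.
  rewrite big_ord_recr /= -addrA IH zE natrD mulrDr exprS; congr (_ + _).
  by rewrite addrAC mulN1r mulNr subrr add0r.
(* By exactness this is the dimension of the image of F_(n+1), which is zero, so the alternating sum
   stops here. *)
have zn : z n.+1 = 0%N.
  have r0 : res_rank F n.+2 = 0%N.
    by apply: (syzygy_theorem Fres) => //; case: Fmin.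
  have : free_dim n.+2 t = 0%N.
    by rewrite /free_dim big1 // => -[k kr]; exfalso; move: kr; rewrite r0.
  by rewrite zE => /eqP; rewrite addn_eq0 => /andP [_ /eqP].
have := HF_has_dim (ideal_subspace idealJ) z0P.
by move=> <-; rewrite natrD (alt n.+1) zn mulr0 addr0 addrK.
Qed.

(** The falling factorial of x - g + m with m factors, divided by m!. The condition [g <= x] keeps
    the subtraction exact. *)
Lemma bin_poly (m g : nat) : exists P : {poly rat}, (size P <= m.+1)%N /\
  forall x : nat, (g <= x)%N -> P.[x%:R] = 'C(x - g + m, m)%:R.
Proof.
exists ((m`!%:R)^-1 *: \prod_(i < m) ('X - (g%:R + i%:R - m%:R)%:P)); split.
  apply: leq_trans (size_scale_leq _ _) _.
  by rewrite size_prod_XsubC -[index_enum _]enumT size_enum_ord.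
move=> x gx; rewrite hornerZ horner_prod.
have fact0 : m`!%:R != 0 :> rat by rewrite pnatr_eq0 -lt0n fact_gt0.
apply: (mulfI fact0); rewrite mulrA divff // mul1r mulrC -natrM bin_ffact.
rewrite ffact_prod natr_prod; apply: eq_bigr => i _; rewrite hornerXsubC.
by rewrite natrB ?natrD ?natrB //; [lra | have := ltn_ord i; lia].
Qed.

(** Beyond r + n the Hilbert function is an alternating sum of binomial polynomials, as the
    generators of F_0, ..., F_n have degree at most r + n. Summation raises the degree to at most n
    + 1. *)
Lemma hilbert_sum_poly (r : nat) :
  (forall i (j : 'I_(grank F i)), (gdeg j <= r + i)%N) ->
  exists Q : {poly rat}, (size Q <= n.+2)%N /\
    forall D, (r + n <= D)%N -> (\sum_(d < D.+1) HF J d)%:R = Q.[D%:R].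
Proof.
move=> gr; have [P Pall] := choice (bin_poly n.+1).
have Psize g : (size (P g) <= n.+2)%N by case: (Pall g).
have Pval g (x : nat) : (g <= x)%N -> (P g).[x%:R] = 'C(x - g + n.+1, n.+1)%:R.
  by case: (Pall g) => _ /(_ x).
(* Pascal's rule: the increments of [P g] are the dimensions of the graded pieces of S(- g). *)
have Pstep g x : (g <= x)%N ->
    (P g).[x.+1%:R] = (P g).[x%:R] + 'C(x.+1 - g + n, x.+1 - g)%:R.
  move=> gx; rewrite !Pval ?leqW // subSn // addSn binS natrD; congr (_ + _%:R).
  by rewrite addnS -addSn -[in LHS]bin_sub ?leq_addl // addnK.
pose Q0 := P 0%N - \sum_(i < n.+1) (-1) ^+ i *: (\sum_j P (deg i.+1 j)).
have Q0size : (size Q0 <= n.+2)%N.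
  apply: leq_trans (size_polyD _ _) _; rewrite geq_max Psize size_polyN.
  apply: size_sum_leq => i; apply: leq_trans (size_scale_leq _ _) _.
  by apply: size_sum_leq => j; apply: Psize.
have Q0step D : (r + n <= D)%N -> Q0.[D.+1%:R] = Q0.[D%:R] + (HF J D.+1)%:R.
  move=> rD; rewrite HF_free_dim /Q0 !hornerE !horner_sum Pstep // subn0.
  rewrite -[RHS]addrA [RHS]addrACA; congr (_ + _).
  rewrite -opprD; congr (- _); rewrite -big_split /=; apply: eq_bigr => i _.
  rewrite !hornerZ !horner_sum -mulrDr; congr (_ * _).
  rewrite /free_dim natr_sum -big_split /=; apply: eq_bigr => j _.
  have jD : (gdeg j <= D)%N.
    by apply: leq_trans (gr i j) (leq_trans _ rD); rewrite leq_add2l -ltnS.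
  by rewrite (leqW jD) Pstep.
(* [Q0] has the right increments from r + n on; the constant corrects its value there. *)
exists (Q0 + ((\sum_(d < (r + n).+1) HF J d)%:R - Q0.[(r + n)%:R])%:P); split.
  apply: leq_trans (size_polyD _ _) _; rewrite geq_max Q0size.
  exact: leq_trans (size_polyC_leq1 _) _.
elim=> [|D IH].
  by rewrite leqn0 => /eqP ->; rewrite hornerD hornerC addrC subrK.
rewrite leq_eqVlt => /orP [/eqP <-|rD]; first by rewrite hornerD hornerC addrC subrK.
rewrite big_ord_recr /= natrD IH // 2!(hornerD Q0) 2!hornerC Q0step //.
by rewrite addrAC.
Qed.

End HilbertFunction.

(** * Counting monomials outside a graded system *)

Section Counting.
Variable n : nat.
Local Notation mono := 'X_{1..n.+1}.

Definition count_outside (U : set mono) D : nat :=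
  #|[set a : 'X_{1..n.+1 < D.+1} | `[< ~ U a >]]%SET|.

Lemma mnm_le_mdeg (a : mono) i : (a i <= mdeg a)%N.
Proof. by rewrite mdegE (bigD1 i) //= leq_addr. Qed.

(** Such a [b] is determined by an index i with b_i < v_i, the value b_i, which is at most [V], and
    the other n exponents, each at most [D]. *)
Lemma card_near_boundary (v : mono) V D : (forall i, (v i <= V)%N) ->
  (#|[set b : 'X_{1..n.+1 < D.+1} | [exists i, b i < v i]%N]%SET| <=
   n.+1 * V.+1 * D.+1 ^ n)%N.
Proof.
move=> vV; set X := finset _.
pose idx (b : 'X_{1..n.+1 < D.+1}) := odflt ord0 [pick i | b i < v i]%N.
have idxP b : b \in X -> (b (idx b) < v (idx b))%N.
  rewrite inE => /existsP [i bi]; rewrite /idx; case: pickP => [//|/(_ i)].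
  by rewrite bi.
pose f (b : 'X_{1..n.+1 < D.+1}) : 'I_n.+1 * 'I_V.+1 * {ffun 'I_n -> 'I_D.+1} :=
  (idx b, inord (b (idx b)), [ffun j => inord (b (lift (idx b) j))]).
have f_inj : {in X &, injective f}.
  move=> b c bX cX [ibc] /(congr1 val) /= + /ffunP bc.
  rewrite !inordK; last 2 first.
  - by rewrite ltnS (leq_trans (ltnW (idxP c cX))).
  - by rewrite ltnS (leq_trans (ltnW (idxP b bX))).
  move=> bci; apply/val_inj/mnmP => i /=.
  have [<-|/unlift_some [j ij _]] := eqVneq (idx b) i; first by rewrite bci ibc.
  have := bc j; rewrite !ffunE -ibc -ij => /(congr1 val) /=.
  by rewrite !inordK // ltnS (leq_trans (mnm_le_mdeg _ _)) // -ltnS bmdeg.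
rewrite -(card_in_imset f_inj) (leq_trans (max_card _)) //.
by rewrite !card_prod card_ffun !card_ord.
Qed.

(** Send [b] to the quotient of b - v by k + 1, paired with the remainders. This is injective on the
    [b] that dominate [v], and the last hypothesis puts the quotient outside [U] when [b] is outside
    [U']. The remaining [b] lie near the boundary. *)
Lemma count_outside_scale (U U' : set mono) (v : mono) V k D D' :
  (forall i, (v i <= V)%N) -> (D' %/ k.+1 <= D)%N ->
  (forall a b : mono, U a -> (forall i, (k.+1 * a i + v i <= b i)%N) -> U' b) ->
  (count_outside U' D' <=
   k.+1 ^ n.+1 * count_outside U D + n.+1 * V.+1 * D'.+1 ^ n)%N.
Proof.
move=> vV DD' UU'; rewrite /count_outside; set X' := finset _; set X := finset _.
pose B := [set b : 'X_{1..n.+1 < D'.+1} | [exists i, b i < v i]%N]%SET.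
have -> : #|X'| = (#|X' :\: B| + #|X' :&: B|)%N by rewrite addnC cardsID.
apply: leq_add; last first.
  by apply: leq_trans (card_near_boundary _ vV); apply/subset_leq_card/subsetIr.
pose quo (b : mono) : mono := [multinom ((b i - v i) %/ k.+1)%N | i < n.+1].
have quo_lt (b : 'X_{1..n.+1 < D'.+1}) : (mdeg (quo b) < D.+1)%N.
  rewrite ltnS (leq_trans _ DD') // leq_divRL // mdegE big_distrl /=.
  apply: (@leq_trans (mdeg b)); last by rewrite -ltnS bmdeg.
  rewrite mdegE; apply: leq_sum => i _; rewrite mnmE.
  exact: leq_trans (leq_trunc_div _ _) (leq_subr _ _).
pose f (b : 'X_{1..n.+1 < D'.+1}) : 'X_{1..n.+1 < D.+1} * {ffun 'I_n.+1 -> 'I_k.+1} :=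
  (BMultinom (quo_lt b), [ffun i => inord ((b i - v i) %% k.+1)]).
have vb (b : 'X_{1..n.+1 < D'.+1}) i : b \in X' :\: B -> (v i <= b i)%N.
  by rewrite !inE => /andP [/existsPn /(_ i)]; rewrite -leqNgt.
have f_inj : {in X' :\: B &, injective f}.
  move=> b c bX cX fbc.
  have /mnmP qbc : quo b = quo c := congr1 (fun x => bmnm x.1) fbc.
  have /ffunP rbc := congr1 snd fbc.
  apply/val_inj/mnmP => i /=; rewrite -(subnK (vb b i bX)) -(subnK (vb c i cX)).
  congr addn; rewrite (divn_eq (b i - v i) k.+1) (divn_eq (c i - v i) k.+1).
  have := qbc i; rewrite !mnmE => ->; congr addn.
  by have := rbc i; rewrite !ffunE => /(congr1 val) /=; rewrite !inordK ?ltn_mod.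
rewrite -(card_in_imset f_inj) mulnC.
have -> : (k.+1 ^ n.+1 = #|[set: {ffun 'I_n.+1 -> 'I_k.+1}]%SET|)%N.
  by rewrite cardsT card_ffun !card_ord.
rewrite -cardsX; apply/subset_leq_card/fintype.subsetP => _ /imsetP [b bX ->].
rewrite finset.in_setX finset.in_setT andbT inE; apply/asboolP => Uq.
have : b \in X' by move: bX; rewrite inE => /andP [].
rewrite inE => /asboolP; apply; apply: (UU' _ _ Uq) => i.
rewrite mnmE /= -[leqRHS](subnK (vb b i bX)) leq_add2r mulnC.
exact: leq_trunc_div.
Qed.

Variable R : realType.

Lemma cvgn_invn : (fun m : nat => m%:R^-1 : R) @ \oo --> (0 : R).
Proof. by rewrite -cvg_shiftS; exact: cvg_harmonic. Qed.

(* The limit is the infimum of [g] over m > 0. *)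
Lemma cvgn_almost_decreasing (g : R ^nat) : (forall m, 0 <= g m) ->
  (forall m, (0 < m)%N -> exists C : R,
     \forall M \near \oo, g M <= g m + C / M%:R) ->
  cvgn g.
Proof.
move=> g0 gC; pose A := [set g m | m in [set m | (0 < m)%N]].
have infA : has_inf A by split; [exists (g 1%N), 1%N | exists 0 => _ [m _ <-]].
apply/cvg_ex; exists (inf A); apply/cvgrPdist_le => e e0.
have e20 : 0 < e / 2 by rewrite divr_gt0.
have [_ [m m0 <-] gm] := inf_adherent e20 infA.
have [C HC] := gC m m0.
have cC : (fun M : nat => C / M%:R) @ \oo --> (0 : R).
  rewrite -[0](mulr0 C); apply: cvgMr.
  exact: cvgn_invn.
move/cvgrPdist_le: cC => /(_ _ e20) hC.
near=> M.
have M0 : (0 < M)%N by near: M; exists 1%N.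
have infM : inf A <= g M by apply: ge_inf; [case: infA | exists M].
have gM : g M <= g m + C / M%:R by near: M.
have CM : `|0 - C / M%:R| <= e / 2 by near: M.
rewrite sub0r normrN in CM.
have := ler_norm (C / M%:R); rewrite ler_norml; lra.
Unshelve. all: by end_near.
Qed.

(** Scaling by k compares [U m] with [U M] for M = k m + r and r < m. The shift [v] depends on r
    alone, so for fixed m finitely many shifts occur and the boundary term is O(M^n). *)
Lemma cvgn_count_outside (U : nat -> set mono) (t : nat) :
  (forall r, exists v : mono, forall m k (a b : mono), (0 < m)%N ->
     U m a -> (forall i, (k * a i + v i <= b i)%N) -> U (k * m + r)%N b) ->
  cvgn (fun m => (count_outside (U m) (m * t))%:R / m%:R ^+ n.+1 : R).
Proof.
move=> /choice [v vP]; apply: cvgn_almost_decreasing => [m|m m0].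
  by rewrite divr_ge0 // exprn_ge0.
pose V := \max_(r < m) \max_i v r i.
(* Since M t + 1 <= M (t + 1), the boundary term is at most this constant times M^n. *)
exists (n.+1 * V.+1 * t.+1 ^ n)%:R.
(* This threshold gives m t < k, hence r t < k, so that the quotient of M t = k m t + r t by k is at
   most m t. *)
exists (m * (m * t).+1)%N => //= M mM.
have M0 : (0 < M)%N by apply: leq_trans mM; rewrite muln_gt0 m0.
have [k [r [kM rm kmt]]] : exists k r,
    [/\ M = (k * m + r)%N, (r < m)%N & (m * t < k)%N].
  exists (M %/ m)%N, (M %% m)%N; split; [exact: divn_eq | by rewrite ltn_mod|].
  by rewrite leq_divRL // mulnC.
have k_gt0 : (0 < k)%N by apply: leq_ltn_trans kmt.
have vV i : (v r i <= V)%N.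
  apply: leq_trans (leq_bigmax (Ordinal rm)).
  exact: (@leq_bigmax _ (fun i => v r i)).
have k0 : (k.-1.+1 = k)%N by exact: prednK.
have cs := @count_outside_scale (U m) (U M) (v r) V k.-1 (m * t) (M * t) vV.
have kD : ((M * t) %/ k <= m * t)%N.
  rewrite -ltnS ltn_divLR // kM mulSn mulnDl addnC -mulnA.
  rewrite [(k * (m * t))%N]mulnC ltn_add2r (leq_ltn_trans _ kmt) //.
  by rewrite leq_mul2r (ltnW rm) orbT.
rewrite k0 in cs; have {cs} cle := cs kD.
have {}cle := cle (fun a b Ua ab => eq_ind_r (fun M => U M b) (vP r m k a b m0 Ua ab) kM).
have M0R : 0 < M%:R :> R by rewrite ltr0n.
have m0R : 0 < m%:R :> R by rewrite ltr0n.
rewrite ler_pdivrMr ?exprn_gt0 // mulrDl.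
have := cle; rewrite -(ler_nat R) natrD => /le_trans; apply; apply: lerD.
  (* The main term: k m <= M bounds (k / M)^(n+1) by (1 / m)^(n+1). *)
  rewrite natrM mulrC -mulrA ler_wpM2l // natrX.
  rewrite -exprVn -exprMn lerXn2r ?nnegrE ?mulr_ge0 ?invr_ge0 //.
  rewrite mulrC ler_pdivlMr // -natrM ler_nat [in leqRHS]kM.
  exact: leq_addr.
rewrite [in leRHS]exprS -mulrA [_^-1 * _]mulrA mulVf ?gt_eqF // mul1r.
rewrite -natrX -natrM ler_nat -!mulnA -expnMn !leq_mul2l /=.
have le_exp a b e : (a <= b)%N -> (a ^ e <= b ^ e)%N.
  by case: e => // e ab; rewrite leq_exp2r.
by apply: le_exp; rewrite mulSn -add1n [(M * t)%N]mulnC leq_add2r.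
Qed.

End Counting.

(** * Convergence *)

Lemma sum_HF (K : fieldType) n (J : set {mpoly K[n.+1]}) D :
  is_ideal J -> is_homogeneous J ->
  (\sum_(d < D.+1) HF J d)%N = count_outside (lead_monomials J) D.
Proof.
move=> iJ hJ; rewrite /count_outside -sum1_card.
rewrite (partition_big (fun a : 'X_{1..n.+1 < D.+1} => Ordinal (bmdeg a)) xpredT) //=.
apply: eq_bigr => d _; rewrite (HF_card (ltn_ord d) iJ hJ) -sum1_card.
by apply: eq_bigl => a; rewrite !inE -val_eqE /= andbC.
Qed.

Lemma horner_nat_inj (p q : {poly rat}) :
  (\forall x \near \oo, p.[x%:R] = q.[x%:R]) -> p = q.
Proof.
move=> [N _ pq]; apply/eqP; rewrite -subr_eq0; apply: contraT => r0.
pose rs := [seq x%:R : rat | x <- iota N (size (p - q))].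
have /(max_poly_roots r0) : all (root (p - q)) rs.
  apply/allP => _ /mapP [x + ->]; rewrite mem_iota => /andP [Nx _].
  by rewrite rootE !hornerE pq // subrr.
rewrite size_map size_iota ltnn map_inj_uniq ?iota_uniq; last first.
  by move=> x y /eqP; rewrite eqr_nat => /eqP.
by move=> /(_ isT).
Qed.

Lemma HP_eq (K : fieldType) n (J : set {mpoly K[n.+1]}) (P : {poly rat}) :
  (\forall t \near \oo, (HF J t)%:R = P.[t%:R]) -> HP J = P.
Proof.
move=> JP; rewrite /HP; case: xgetP => [P' _ /= JP'|/(_ P) //].
apply: horner_nat_inj; near=> x.
transitivity ((HF J x)%:R : rat); last by near: x.
by apply/esym; near: x.
Unshelve. all: by end_near.
Qed.

(** * Limits of sequences of polynomials of bounded degree *)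

Section Limits.
Variable R : realType.

Lemma eq_near_cvgn (f g : R ^nat) :
  (\forall m \near \oo, f m = g m) -> cvgn g -> cvgn f.
Proof.
move=> fg /cvg_ex [l gl]; apply/cvg_ex; exists l.
by apply: cvg_trans gl; apply: near_eq_cvg; apply: filterS fg => m ->.
Qed.

Lemma eq_near_limn (f g : R ^nat) :
  (\forall m \near \oo, f m = g m) -> cvgn g -> limn f = limn g.
Proof.
move=> fg cg; apply/cvg_lim => //; apply: cvg_trans cg.
by apply: near_eq_cvg; apply: filterS fg => m ->.
Qed.

Lemma is_cvgn_sum (I : Type) (r : seq I) (f : I -> R ^nat) :
  (forall i, cvgn (f i)) -> cvgn (fun m => \sum_(i <- r) f i m).
Proof.
move=> cf; elim: r => [|i r IH].
  by under eq_fun do rewrite big_nil; apply: is_cvg_cst.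
by under eq_fun do rewrite big_cons; apply: is_cvgD.
Qed.

Lemma is_cvgn_expr (f : R ^nat) k : cvgn f -> cvgn (fun m => f m ^+ k).
Proof.
move=> cf; elim: k => [|k IH].
  by under eq_fun do rewrite expr0; apply: is_cvg_cst.
by under eq_fun do rewrite exprS; apply: is_cvgM.
Qed.

(** The Vandermonde matrix of distinct points is invertible, so each coefficient is a fixed linear
    combination of the values at these points. *)
Lemma is_cvgn_coef N (x : 'I_N -> R) (q : nat -> {poly R}) :
  injective x -> (forall m, size (q m) <= N)%N ->
  (forall j, cvgn (fun m => (q m).[x j])) ->
  forall k, cvgn (fun m => (q m)`_k).
Proof.
move=> x_inj qN qx k; have [kN|Nk] := ltnP k N; last first.
  have -> : (fun m => (q m)`_k) = fun=> 0.
    by apply: funext => m; apply: nth_default; apply: leq_trans Nk.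
  exact: is_cvg_cst.
pose V : 'M[R]_N := Vandermonde N (\row_j x j).
have Vu : V \in unitmx.
  rewrite unitmxE unitfE det_Vandermonde; apply/prodf_neq0 => i _.
  apply/prodf_neq0 => j ij; rewrite !mxE subr_eq0 (inj_eq x_inj).
  by apply: contraTneq ij => ->; rewrite ltnn.
have qE m : (q m)`_k = \sum_j (q m).[x j] * invmx V j (Ordinal kN).
  pose u : 'rV[R]_N := \row_i (q m)`_i.
  have -> : (q m)`_k = u 0 (Ordinal kN) by rewrite mxE.
  rewrite -(mulmxK Vu u) mxE; apply: eq_bigr => j _; congr (_ * _).
  rewrite mxE (horner_coef_wide _ (qN m)); apply: eq_bigr => i _.
  by rewrite !mxE.
under eq_fun do rewrite qE; apply: is_cvgn_sum => j.
by apply: is_cvgM; [exact: qx | exact: is_cvg_cst].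
Qed.

Variables (n A : nat) (Q : nat -> {poly rat}) (h : nat -> nat -> nat).
Hypothesis Qsize : forall m, (size (Q m) <= n.+2)%N.
Hypothesis hQ : \forall m \near \oo, forall D, (A * m <= D)%N ->
  (\sum_(d < D.+1) h m d)%:R = (Q m).[D%:R].
Hypothesis hcvg : forall t,
  cvgn (fun m => (\sum_(d < (m * t).+1) h m d)%:R / m%:R ^+ n.+1 : R).

Let q m : {poly R} :=
  \poly_(k < n.+2) (ratr (Q m)`_k * m%:R ^+ k / m%:R ^+ n.+1).

Let q_horner m x :
  (q m).[x] = (map_poly ratr (Q m)).[m%:R * x] / m%:R ^+ n.+1.
Proof.
rewrite horner_poly (@horner_coef_wide _ n.+2) ?(leq_trans (size_poly _ _)) //.
rewrite mulr_suml; apply: eq_bigr => k _; rewrite coef_map /= exprMn.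
by rewrite [LHS]mulrAC -!mulrA.
Qed.

Let q_coef_cvg k : cvgn (fun m => (q m)`_k).
Proof.
(* At the points A, ..., A + n + 1, [hQ] identifies the values, for large m, with the sums that
   converge by [hcvg]. *)
apply: (@is_cvgn_coef n.+2 (fun j => (A + j)%:R)) => [i j /eqP|m|j].
- by rewrite eqr_nat eqn_add2l => /eqP /val_inj.
- exact: size_poly.
- apply: (eq_near_cvgn _ (@hcvg (A + j)%N)); near=> m.
  rewrite q_horner -natrM -[_%:R](ratr_nat R) horner_map /=.
  rewrite -(_ : (\sum_(d < (m * (A + j)).+1) h m d)%:R = (Q m).[_]) ?ratr_nat //.
  have Qm : forall D, (A * m <= D)%N ->
      (\sum_(d < D.+1) h m d)%:R = (Q m).[D%:R] by near: m.
  by apply: Qm; rewrite mulnC leq_mul2l leq_addr orbT.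
Unshelve. all: by end_near.
Qed.

(** Convergence is deduced from the coefficients of [q m] and not from its values, so it holds for
    every [t], also below [A]. *)
Lemma cvgn_difference_poly (t : nat) :
  cvgn (fun m => ratr (Q m - (Q m \Po ('X - 1))).[(m * t)%:R] / m%:R ^+ n : R).
Proof.
(* For m > 0 this is m (t^k - (t - 1/m)^k), with the factor 1/m of the difference of powers
   cancelled. *)
pose w k (m : nat) : R := \sum_(i < k) t%:R ^+ (k.-1 - i) * (t%:R - m%:R^-1) ^+ i.
apply: (@eq_near_cvgn _ (fun m => \sum_(k < n.+2) (q m)`_k * w k m)); last first.
  apply: is_cvgn_sum => k; apply: is_cvgM; first exact: q_coef_cvg.
  apply: is_cvgn_sum => i; apply: is_cvgM; first exact: is_cvg_cst.
  apply: is_cvgn_expr; apply: is_cvgB; first exact: is_cvg_cst.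
  by apply/cvg_ex; exists 0; apply: cvgn_invn.
exists 1%N => //= m m0; have m0R : m%:R != 0 :> R by rewrite pnatr_eq0 -lt0n.
have -> : \sum_(k < n.+2) (q m)`_k * w k m =
    m%:R * ((q m).[t%:R] - (q m).[t%:R - m%:R^-1]).
  rewrite !(@horner_coef_wide _ n.+2 (q m)) ?size_poly // -sumrB mulr_sumr.
  apply: eq_bigr => k _; rewrite -mulrBr subrXX opprB addrCA subrr addr0.
  by rewrite [RHS]mulrCA mulVKf.
rewrite !q_horner -mulrBl [m%:R ^+ n.+1]exprS invfM [RHS]mulrCA mulVKf //.
rewrite [m%:R * (_ - _)]mulrBr divff //; congr (_ / _).
rewrite hornerD hornerN horner_comp !hornerE rmorphB /=; congr (_ - _).
  by rewrite -horner_map /= ratr_nat natrM.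
by rewrite -horner_map /= rmorphB /= ratr_nat rmorph1 natrM.
Qed.

End Limits.

(** * Symbolic powers *)

Section SymbolicPowers.
Variable S : idomainType.
Implicit Types (I J Q : set S).

Lemma ideal_gen_ideal (A : set S) : is_ideal (ideal_gen A).
Proof.
split=> [J [[J0 _ _] _] //|p q Ap Aq J JA|a p Ap J JA].
  by have [[_ JD _] _] := JA; apply: JD; [exact: Ap | exact: Aq].
by have [[_ _ JM] _] := JA; apply: JM; exact: Ap.
Qed.

Lemma ideal_pow_ideal I m : is_ideal (ideal_pow I m).
Proof. exact: ideal_gen_ideal. Qed.

Lemma colon_ideal J q : is_ideal J -> is_ideal [set p | J (p * q)].
Proof.
move=> [J0 JD JM]; split=> /= [|p r|a p]; first by rewrite mul0r.
  by rewrite mulrDl; apply: JD.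
by rewrite -mulrA; apply: JM.
Qed.

(** For fixed [q], the [p] with p q in the target form an ideal, so generators suffice. Doing this
    in both factors leaves products of a + b elements of [I]. *)
Lemma ideal_powD I a b p q :
  ideal_pow I a p -> ideal_pow I b q -> ideal_pow I (a + b) (p * q).
Proof.
have iI := ideal_pow_ideal I (a + b); move=> Ip Iq.
suff : ideal_pow I a `<=` [set p | ideal_pow I (a + b) (p * q)] by apply.
apply: smallest_sub; first exact: colon_ideal.
move=> _ [f If <-] /=; rewrite mulrC.
suff : ideal_pow I b `<=` [set q | ideal_pow I (a + b) (q * \prod_(i < a) f i)].
  by apply.
apply: smallest_sub; first exact: colon_ideal.
move=> _ [g Ig <-] /=; rewrite mulrC; apply: sub_gen_smallest.
exists (fun i : 'I_(a + b) => match fintype.split i with inl j => f j | inr j => g j end).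
  by move=> i /=; case: (fintype.split i) => j; [exact: If | exact: Ig].
rewrite big_split_ord /=; congr (_ * _); apply: eq_bigr => i _.
  by rewrite (unsplitK (inl i)).
by rewrite (unsplitK (inr i)).
Qed.

Lemma ideal_pow_expr I m p : I p -> ideal_pow I m (p ^+ m).
Proof.
move=> Ip; apply: sub_gen_smallest; exists (fun=> p) => //.
by rewrite prodr_const card_ord.
Qed.

(** Denominators can be cleared, because elements outside a prime are nonzero. *)
Lemma symbolic_powerP I m p : symbolic_power I m p <->
  forall Q, Ass I Q -> exists2 s, ~ Q s & ideal_pow I m (s * p).
Proof.
have sP Q s : Ass I Q -> ~ Q s -> FracField.tofrac s != 0.
  move=> [[[Q0 _ _] _ _] _] Qs; rewrite tofrac_eq0.
  by apply/eqP => s0; apply: Qs; rewrite s0.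
split=> Ip Q AQ.
  have [p' Ip' [s /= Qs ps]] := Ip Q AQ; exists s => //.
  suff -> : s * p = p' by [].
  apply/eqP; rewrite -tofrac_eq tofracM -ps mulrC divfK //.
  exact: sP Qs.
have [s Qs Isp] := Ip Q AQ; exists (s * p) => //; exists s => //.
by rewrite tofracM mulrC mulKf //; apply: sP Qs.
Qed.

Lemma symbolic_power_ideal I m : is_ideal (symbolic_power I m).
Proof.
have [J0 JD JM] := ideal_pow_ideal I m.
split=> [|p q /symbolic_powerP Ip /symbolic_powerP Iq|a p /symbolic_powerP Ip];
  apply/symbolic_powerP => Q AQ; have [[_ Q1 QM] _] := AQ.
- by exists 1 => //; rewrite mulr0.
- have [s Qs Isp] := Ip Q AQ; have [r Qr Irq] := Iq Q AQ.
  exists (s * r); first by move=> /QM [].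
  by rewrite mulrDr; apply: JD; [rewrite mulrAC mulrC | rewrite -mulrA];
    apply: JM.
- have [s Qs Isp] := Ip Q AQ; exists s => //.
  by rewrite mulrCA; apply: JM.
Qed.

Lemma symbolic_powerD I a b p q : symbolic_power I a p ->
  symbolic_power I b q -> symbolic_power I (a + b) (p * q).
Proof.
move=> /symbolic_powerP Ip /symbolic_powerP Iq; apply/symbolic_powerP => Q AQ.
have [s Qs Isp] := Ip Q AQ; have [r Qr Irq] := Iq Q AQ.
exists (s * r); first by have [[_ _ QM] _] := AQ; move=> /QM [].
by rewrite mulrACA; apply: ideal_powD.
Qed.

Lemma ideal_pow_symbolic I m p : ideal_pow I m p -> symbolic_power I m p.
Proof.
move=> Ip; apply/symbolic_powerP => Q [[_ Q1 _] _].
by exists 1 => //; rewrite mul1r.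
Qed.

Lemma symbolic_power_expr I m k p :
  symbolic_power I m p -> symbolic_power I (k * m) (p ^+ k).
Proof.
move=> Ip; elim: k => [|k IH].
  rewrite mul0n expr0; apply: ideal_pow_symbolic.
  by apply: sub_gen_smallest; exists (fun=> 0); [case | rewrite big_ord0].
by rewrite mulSn exprS; apply: symbolic_powerD.
Qed.

Lemma symbolic_power0 I m p : (0 < m)%N -> is_ideal I ->
  (forall q, I q -> q = 0) -> symbolic_power I m p -> p = 0.
Proof.
move=> m0 [I0 _ _] Iz /symbolic_powerP Ip.
have I0P q : I q <-> q = 0 by split=> [/Iz|->].
have iZ : is_ideal [set q : S | q = 0].
  by split=> //= [p' q -> ->|a q ->]; rewrite ?addr0 ?mulr0.
(* The zero ideal of a domain is prime and is the annihilator of 1 modulo I = 0, hence an associated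
   prime. *)
have [|s Qs] := Ip [set q | q = 0].
  split; last first.
    by exists 1; apply/seteqP; split=> q /=; rewrite mulr1 => /I0P.
  split=> //=; first by apply/eqP; rewrite oner_eq0.
  by move=> q r /eqP; rewrite mulf_eq0 => /orP [] /eqP; [left|right].
have : ideal_pow I m `<=` [set q | q = 0].
  apply: smallest_sub => // _ [f If <-] /=.
  by rewrite (bigD1 (Ordinal m0)) //= (Iz _ (If _)) mul0r.
move=> /[apply] /eqP; rewrite mulf_eq0 => /orP [/eqP //|/eqP //].
Qed.

End SymbolicPowers.

(** For [p] in I^(m) and a nonzero [p0] in [I], the product p^k p0^r lies in I^(km+r), and leading
    monomials multiply; [v] is that of p0^r. If I = 0, then I^(m) = 0 for m > 0 and there is no
    leading monomial [a]. *)
Lemma lead_monomials_symbolic (K : fieldType) n (I : set {mpoly K[n]}) r :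
  is_ideal I ->
  exists v : 'X_{1..n}, forall m k (a b : 'X_{1..n}), (0 < m)%N ->
    lead_monomials (symbolic_power I m) a ->
    (forall i, (k * a i + v i <= b i)%N) ->
    lead_monomials (symbolic_power I (k * m + r)) b.
Proof.
move=> iI; have [[p0 [Ip0 p0n]]|I0] := EM (exists p, I p /\ p != 0); last first.
  exists 0%MM => m k a b m0 [p [Ip /eqP p0 _]]; case: p0.
  apply: symbolic_power0 Ip => // q Iq; apply/eqP; apply: contraT => q0.
  by case: I0; exists q.
exists (mlead (p0 ^+ r)) => m k a b _ [p [Ip pn <-]] ab.
pose e := (b - (mlead p *+ k + mlead (p0 ^+ r)))%MM.
exists ('X_[e] * (p ^+ k * p0 ^+ r)).
have pk : p ^+ k != 0 by exact: expf_neq0.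
have pr : p0 ^+ r != 0 by exact: expf_neq0.
have e0 : 'X_[e] != 0 :> {mpoly K[n]}.
  by apply/eqP => /(congr1 (mcoeff e))/eqP; rewrite mcoeffX eqxx mcoeff0 oner_eq0.
split.
- have [_ _ JM] := symbolic_power_ideal I (k * m + r); apply: JM.
  apply: symbolic_powerD; first exact: symbolic_power_expr.
  by apply: ideal_pow_symbolic; apply: ideal_pow_expr.
- by apply: mulf_neq0 => //; apply: mulf_neq0.
- rewrite mleadM ?mulf_neq0 // mleadM // mleadX // mleadXm submK //.
  by apply/mnm_lepP => i; rewrite mnmDE mulmnE mulnC.
Qed.

(** * Degree bounds from linearly bounded regularity *)

Section Regularity.
Variables (R : realType) (K : fieldType) (n : nat).
Implicit Types (I J : set (homog_coord_ring K n)).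

(** An infimum strictly below r + 1 yields a resolution of regularity below r + 1; in particular one
    exists, as an empty infimum is +oo. *)
Lemma CM_reg_bound J (r : nat) : (CM_reg R J <= r%:R%:E)%E ->
  exists F, minimal_graded_free_resolution J F /\
    forall i (j : 'I_(grank F i)), (gdeg j <= r.+1 + i)%N.
Proof.
move=> Jr; have : (CM_reg R J < r.+1%:R%:E)%E.
  by apply: le_lt_trans Jr _; rewrite lte_fin ltr_nat.
move=> /ereal_inf_lt [_ [F JF <-] Fr]; exists F; split=> // i j.
have : (((gdeg j)%:R - i%:R)%:E <= resolution_reg R F)%E.
  by apply: ereal_sup_ubound; exists i, j.
move=> /le_lt_trans /(_ Fr); rewrite lte_fin ltrBlDr -natrD ltr_nat.
exact: ltnW.
Qed.

Lemma LBSR_bound I : LBSR R I -> exists A : nat, \forall m \near \oo,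
  exists F r, [/\ minimal_graded_free_resolution (symbolic_power I m) F,
    (r + n <= A * m)%N & forall i (j : 'I_(grank F i)), (gdeg j <= r + i)%N].
Proof.
move=> [a [b [a0 b0 regm]]].
pose a' := (Num.truncn a).+1; pose b' := (Num.truncn b).+1.
(* For r = a' m + b' + 1 and m > 0, this constant times m is at least r + n. *)
exists (a' + b'.+1 + n)%N; near=> m.
have m0 : (0 < m)%N by near: m; exists 1%N.
have : (CM_reg R (symbolic_power I m) <= (a * m%:R + b)%:E)%E by near: m.
have aa' : a <= a'%:R by apply/ltW/truncnS_gt.
have bb' : b <= b'%:R by apply/ltW/truncnS_gt.
move=> rm; have [|F [mF gF]] := @CM_reg_bound (symbolic_power I m) (a' * m + b').
  apply: le_trans rm _; rewrite lee_fin natrD natrM lerD // ler_wpM2r //.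
exists F, (a' * m + b').+1; split=> //.
by rewrite -addnS !mulnDl leq_add ?leq_add // leq_pmulr.
Unshelve. all: by end_near.
Qed.

End Regularity.

(** * Existence of [aHP] and agreement with [aHF] *)

Theorem theorem13 (R : realType) (K : closedFieldType)
    (charK : [pchar K] =i pred0) (n : nat) (n_gt0 : (0 < n)%N)
    (I : set (homog_coord_ring K n))
    (idealI : is_ideal I) (homogI : is_homogeneous I) (radI : is_radical I)
    (lbsrI : LBSR R I) :
  (forall t : nat, (0 < t)%N -> cvgn (aHP_seq R I t)) /\
  (\forall t \near \oo, cvgn (aHF_seq R I t) /\ aHP R I t = aHF R I t).
Proof.
have [A HA] := LBSR_bound lbsrI.
pose h m d := HF (symbolic_power I m) d.
pose good m (Q : {poly rat}) := is_homogeneous (symbolic_power I m) /\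
  forall D, (A * m <= D)%N -> (\sum_(d < D.+1) h m d)%:R = Q.[D%:R].
pose bounded (Q : {poly rat}) := (size Q <= n.+2)%N.
(* The default 0, taken when no bounded good polynomial exists, makes the size bound hold for every
   m. *)
have exQ m : exists Q, bounded Q /\
    ((exists Q', bounded Q' /\ good m Q') -> good m Q).
  have [[Q' [Q's Q'g]]|nQ] := EM (exists Q', bounded Q' /\ good m Q').
    by exists Q'.
  by exists 0; split=> [|/nQ //]; rewrite /bounded size_poly0.
have [Q QP] := choice exQ.
have goodQ : \forall m \near \oo, good m (Q m).
  apply: filterS HA => m [F [r [mF rA gF]]]; apply: (QP m).2.
  have iJ := symbolic_power_ideal I m.
  have [Q' [Q's Q'E]] := hilbert_sum_poly iJ mF gF.
  (* Homogeneity of I^(m), needed to count [HF] by leading monomials, is read off its graded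
     resolution. *)
  exists Q'; split=> //; split; first exact: resolution_homogeneous mF.
  by move=> D AD; apply: Q'E; apply: leq_trans AD.
have hcvg t : cvgn (fun m => (\sum_(d < (m * t).+1) h m d)%:R / m%:R ^+ n.+1 : R).
  have := @cvgn_count_outside n R (fun m => lead_monomials (symbolic_power I m)) t
    (fun r => lead_monomials_symbolic r idealI).
  apply: eq_near_cvgn; apply: filterS goodQ => m [hm _].
  by rewrite sum_HF //; exact: symbolic_power_ideal.
(* The difference of consecutive sums: for large m it gives the Hilbert function beyond A m, so it
   is the Hilbert polynomial. *)
pose P m := Q m - (Q m \Po ('X - 1)).
have hP : \forall m \near \oo, forall D, (A * m < D)%N -> (h m D)%:R = (P m).[D%:R].
  apply: filterS goodQ => m [_ Qm] [//|D] AD.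
  have XD : ('X - 1 : {poly rat}).[D.+1%:R] = D%:R by rewrite !hornerE -natr1 addrK.
  rewrite hornerD hornerN horner_comp XD.
  by rewrite -!Qm ?(ltnW AD) // big_ord_recr /= natrD addrC addKr.
have HPE : \forall m \near \oo, HP (symbolic_power I m) = P m.
  by apply: filterS hP => m hm; apply: HP_eq; exists (A * m).+1.
have Pcvg t : cvgn (fun m => ratr (P m).[(m * t)%:R] / m%:R ^+ n : R).
  apply: (@cvgn_difference_poly _ n A Q h _ _ hcvg t) => [m|].
    by case: (QP m).
  by apply: filterS goodQ => m [].
have aHPE t : \forall m \near \oo,
    aHP_seq R I t m = ratr (P m).[(m * t)%:R] / m%:R ^+ n.
  by apply: filterS HPE => m Pm; rewrite /aHP_seq Pm.
split=> [t _|]; first exact: eq_near_cvgn (aHPE t) (Pcvg t).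
(* For t > A and m > 0 the degree m t exceeds A m strictly, as [hP] demands. *)
exists A.+1 => //= t At.
have aHFE : \forall m \near \oo,
    aHF_seq R I t m = ratr (P m).[(m * t)%:R] / m%:R ^+ n.
  near=> m; rewrite /aHF_seq -/(h m _).
  have m0 : (0 < m)%N by near: m; exists 1%N.
  have hm : forall D, (A * m < D)%N -> (h m D)%:R = (P m).[D%:R] by near: m.
  by rewrite -hm ?ratr_nat // mulnC ltn_pmul2l.
split; first exact: eq_near_cvgn aHFE (Pcvg t).
by rewrite /aHP /aHF (eq_near_limn (aHPE t)) // (eq_near_limn aHFE).
Unshelve. all: by end_near.
Qed.
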